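(* Let $\Pi$ be the equality-test conditional encryption construction described in the context, with message space $\Sigma^{\le n}$ and predicate $P_=$, where $P_=(m_1,m_2)=1$ if and only if $m_1=m_2$. Then $\Pi$ is a perfectly correct and $1-\epsilon(\lambda)$-error detecting conditional encryption scheme for $P_=$ with $$\epsilon(\lambda)=\frac{|\Sigma|^{n+1}}{N}\le\frac{1}{\max\{p,q\}},$$ where $N=pq$ is the modulus of the (fixed) public key output by $\mathsf{KeyGen}(1^\lambda)$.
   Context: **Conditional encryption.** For a binary predicate $P:\mathcal M\times\mathcal M\to\{0,1\}$, a conditional encryption scheme consists of algorithms $(\mathsf{KeyGen},\mathsf{Enc},\mathsf{CondEnc},\mathsf{Dec})$: $(sk,pk)=\mathsf{KeyGen}(1^\lambda;r)$; $\mathsf{Enc}_{pk}(m_1;r)$ outputs a ciphertext $(0,c)$ with flag $0$; $\mathsf{CondEnc}_{pk}((0,c),m_2,m_3;r)$ takes a regular ciphertext, a control message $m_2$ and a payload message $m_3$ and outputs a ciphertext $(1,\tilde c)$ with flag $1$ (and outputs $\bot$ if the input ciphertext has flag $1$); $\mathsf{Dec}_{sk}$ takes a flagged ciphertext and outputs a message in $\mathcal M$ or $\bot$. *Correctness.* The scheme is $1-\epsilon(\cdot)$-correct if (i) for all coins $r_1,r_2$ and $m\in\mathcal M$, with $(sk,pk)=\mathsf{KeyGen}(1^\lambda;r_1)$, $\mathsf{Dec}_{sk}(\mathsf{Enc}_{pk}(m;r_2))=m$; and (ii) for all $r_1,r_2$ and all $m_1,m_2,m_3\in\mathcal M$ with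 $P(m_1,m_2)=1$, $\Pr_{r_3}[\mathsf{Dec}_{sk}(\mathsf{CondEnc}_{pk}(\mathsf{Enc}_{pk}(m_1;r_2),m_2,m_3;r_3))=m_3]\ge 1-\epsilon(\lambda)$. It is (perfectly) correct if $\epsilon=0$. *Error detection.* The scheme is $1-\epsilon(\cdot)$-error detecting if for all $r_1,r_2$ and all $m_1,m_2,m_3\in\mathcal M$ with $P(m_1,m_2)=0$, with $(sk,pk)=\mathsf{KeyGen}(1^\lambda;r_1)$, $\Pr_{r_3}[\mathsf{Dec}_{sk}(\mathsf{CondEnc}_{pk}(\mathsf{Enc}_{pk}(m_1;r_2),m_2,m_3;r_3))=\bot]\ge 1-\epsilon(\lambda)$. **Paillier.** The public key is $(N,g)$ with $N=pq$, $p,q$ distinct primes, $\gcd(N,(p-1)(q-1))=1$, $g=N+1$. The secret key is $(\beta,\mu)$ with $\beta=\mathrm{lcm}(p-1,q-1)$, $\mu=(L(g^\beta \bmod N^2))^{-1}\bmod N$, $L(u)=(u-1)/N$. Encryption of $m\in\mathbb Z_N$ with nonce $r\in\mathbb Z_N^*$ is $g^m r^N \bmod N^2$; decryption of $c\in\mathbb Z_{N^2}^*$ is $L(c^\beta\bmod N^2)\cdot\mu\bmod N$. Write $\mathsf{P.Enc}$, $\mathsf{P.Dec}$ for these. **The equality-test construction.** $\Sigma$ is a finite alphabet, $\Sigma^{\le n}$ the set of strings of length at most $n$. $\mathsf{ToInt}:\Sigma^{\le n}\to\mathbb Z_{|\Sigma|^{n+1}}=\{0,\dots,|\Sigma|^{n+1}-1\}$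 is a fixed injective map, and $\mathsf{ToInt}^{-1}(y)$ is the preimage of $y$, or $\bot$ if there is none. - $\mathsf{KeyGen}$: Paillier key generation, repeated until $|\Sigma|^{n+1}<\min\{p,q\}$ and $\gcd(N,(p-1)(q-1))=1$. - $\mathsf{Enc}_{pk}(m)=(0,\mathsf{P.Enc}_{pk}(\mathsf{ToInt}(m)))$ with fresh nonce. - $\mathsf{CondEnc}_{pk}((b,c),m_2,m_3)$: if $b=1$ or $\gcd(c,N)\ne1$ return $\bot$. Otherwise let $\hat m_2=\mathsf{ToInt}(m_2)$, $\hat m_3=\mathsf{ToInt}(m_3)$, pick uniform $R\in\mathbb Z_N$ and $r\in\mathbb Z_N^*$, and return $(1,c^=)$ with $c^= = c^R(N+1)^{-R\hat m_2+\hat m_3}r^N\bmod N^2$. - $\mathsf{Dec}_{sk}(b,c)=\mathsf{ToInt}^{-1}(\mathsf{P.Dec}_{sk}(c))$ for $b\in\{0,1\}$. *)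

(* Defs.v *)
From HB Require Import structures.
From mathcomp Require Import all_boot all_order all_algebra.
Set Implicit Arguments.
Unset Strict Implicit.
Unset Printing Implicit Defensive.
Import Order.TTheory GRing.Theory Num.Theory.
Local Open Scope ring_scope.

(* Flags are booleans (false = 0, true = 1) and the failure symbol is None.
   The coins of Enc and CondEnc are uniform on finite types that may depend on
   the public key. KeyGen is partial in its coins, since it may be a rejection
   loop: None means that no key pair is produced from these coins. *)
Record cond_enc_alg (M : Type) := CondEncAlg {
  ce_SK : Type;
  ce_PK : Type;
  ce_CT : Type;
  ce_kcoins : Type;
  ce_ecoins : ce_PK -> finType;
  ce_ccoins : ce_PK -> finType;
  ce_keygen : nat -> ce_kcoins -> option (ce_SK * ce_PK);
  ce_enc : forall pk : ce_PK, M -> ce_ecoins pk -> bool * ce_CT;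
  ce_condenc : forall pk : ce_PK,
    bool * ce_CT -> M -> M -> ce_ccoins pk -> option (bool * ce_CT);
  ce_dec : ce_SK -> bool * ce_CT -> option M
}.

Arguments ce_enc {M} _ pk _ _.
Arguments ce_condenc {M} _ pk _ _ _ _.
Arguments ce_dec {M} _ _ _.
Arguments ce_keygen {M} _ _ _.

(* The flag discipline. The third clause allows CondEnc to reject malformed
   ciphertexts of flag 0; by the last one it never rejects an honest one. *)
Definition cond_enc_scheme (M : Type) (Pi : cond_enc_alg M) : Prop :=
  [/\ forall pk m r, (ce_enc Pi pk m r).1 = false,
      forall pk c m2 m3 r, ce_condenc Pi pk (true, c) m2 m3 r = None,
      forall pk c m2 m3 r c', ce_condenc Pi pk c m2 m3 r = Some c' ->
        c'.1 = true
    & forall lam r1 sk pk, ce_keygen Pi lam r1 = Some (sk, pk) ->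
      forall r2 m1 m2 m3 r3,
        exists c, ce_condenc Pi pk (ce_enc Pi pk m1 r2) m2 m3 r3
                  = Some (true, c)].

Definition unif_pr (R : realFieldType) (T : finType) (A : {set T}) : R :=
  #|A|%:R / #|T|%:R.

(* Dec (CondEnc (Enc m1) m2 m3), where decrypting a failure is a failure. *)
Definition dec_condenc (M : Type) (Pi : cond_enc_alg M) (sk : ce_SK Pi)
    (pk : ce_PK Pi) (m1 m2 m3 : M) (r2 : ce_ecoins pk) (r3 : ce_ccoins pk) :
    option M :=
  obind (ce_dec Pi sk) (ce_condenc Pi pk (ce_enc Pi pk m1 r2) m2 m3 r3).

Arguments dec_condenc {M Pi} sk pk m1 m2 m3 r2 r3.

(* The error bound may depend on the public key as well as on the security
   parameter; a bound in the security parameter alone is the constant case. *)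
Definition ce_correct (R : realFieldType) (M : eqType) (Pi : cond_enc_alg M)
    (P : rel M) (eps : nat -> ce_PK Pi -> R) : Prop :=
  (forall lam r1 sk pk, ce_keygen Pi lam r1 = Some (sk, pk) ->
     forall r2 m, ce_dec Pi sk (ce_enc Pi pk m r2) = Some m) /\
  (forall lam r1 sk pk, ce_keygen Pi lam r1 = Some (sk, pk) ->
     forall r2 m1 m2 m3, P m1 m2 ->
       1 - eps lam pk <=
         unif_pr R [set r3 | dec_condenc sk pk m1 m2 m3 r2 r3 == Some m3]).

Definition ce_perfectly_correct (R : realFieldType) (M : eqType)
    (Pi : cond_enc_alg M) (P : rel M) : Prop :=
  ce_correct P (fun (_ : nat) (_ : ce_PK Pi) => 0 : R).

Definition ce_error_detecting (R : realFieldType) (M : eqType)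
    (Pi : cond_enc_alg M) (P : rel M) (eps : nat -> ce_PK Pi -> R) : Prop :=
  forall lam r1 sk pk, ce_keygen Pi lam r1 = Some (sk, pk) ->
    forall r2 m1 m2 m3, ~~ P m1 m2 ->
      1 - eps lam pk <=
        unif_pr R [set r3 | dec_condenc sk pk m1 m2 m3 r2 r3 == None].

(* Every modulus N of a generated key is a product of two primes, so that 'Z_N
   and 'Z_(N ^ 2) below really are the integers mod N and mod N ^ 2. Residues
   are stored as their least nonnegative representatives in nat. *)
Record paillier_pk := PaillierPK { pk_N : nat; pk_g : nat }.

(* The modulus is kept in the secret key because decryption reduces mod N. *)
Record paillier_sk := PaillierSK { sk_N : nat; sk_beta : nat; sk_mu : nat }.

Definition paillier_L (N u : nat) : nat := (u.-1 %/ N)%N.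

Definition paillier_keys (p q : nat) : paillier_sk * paillier_pk :=
  let N := (p * q)%N in
  let g := N.+1 in
  let beta := lcmn p.-1 q.-1 in
  let u : 'Z_(N ^ 2) := g%:R ^+ beta in
  let mu : 'Z_N := (paillier_L N u)%:R^-1 in
  (PaillierSK N beta mu, PaillierPK N g).

Definition paillier_enc (pk : paillier_pk) (m : nat) (r : {unit 'Z_(pk_N pk)}) :
    nat :=
  let N := pk_N pk in
  let c : 'Z_(N ^ 2) := (pk_g pk)%:R ^+ m * (val r : nat)%:R ^+ N in c.

Definition paillier_dec (sk : paillier_sk) (c : nat) : nat :=
  let N := sk_N sk in
  let u : 'Z_(N ^ 2) := c%:R ^+ sk_beta sk in
  ((paillier_L N u * sk_mu sk) %% N)%N.

Definition from_int (Sigma : finType) (n : nat)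
    (ToInt : n.-bseq Sigma -> 'I_(#|Sigma| ^ n.+1)) (y : nat) :
    option (n.-bseq Sigma) :=
  [pick m | (ToInt m : nat) == y].

Definition eqtest_accept (Sigma : finType) (n : nat) (pq : nat * nat) : bool :=
  (#|Sigma| ^ n.+1 < minn pq.1 pq.2)%N
  && coprime (pq.1 * pq.2) (pq.1.-1 * pq.2.-1).

(* Here primegen is the prime sampler of Paillier key generation and C its
   coins; the random tape of the rejection loop is a finite sequence of such
   coins, and None means that the tape is exhausted before a pair is accepted. *)
Definition eqtest_primes (Sigma : finType) (n : nat) (C : Type)
    (primegen : nat -> C -> nat * nat) (lam : nat) (tape : seq C) :
    option (nat * nat) :=
  ohead [seq pq <- map (primegen lam) tape | eqtest_accept Sigma n pq].

Definition eqtest_keygen (Sigma : finType) (n : nat) (C : Type)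
    (primegen : nat -> C -> nat * nat) (lam : nat) (tape : seq C) :
    option (paillier_sk * paillier_pk) :=
  omap (fun pq => paillier_keys pq.1 pq.2) (eqtest_primes Sigma n primegen lam tape).

Definition eqtest_enc (Sigma : finType) (n : nat)
    (ToInt : n.-bseq Sigma -> 'I_(#|Sigma| ^ n.+1)) (pk : paillier_pk)
    (m : n.-bseq Sigma) (r : {unit 'Z_(pk_N pk)}) : bool * nat :=
  (false, paillier_enc (ToInt m) r).

(* The exponent of N + 1 is an integer, possibly negative; N + 1 is a unit of
   'Z_(N ^ 2). *)
Definition eqtest_condenc (Sigma : finType) (n : nat)
    (ToInt : n.-bseq Sigma -> 'I_(#|Sigma| ^ n.+1)) (pk : paillier_pk)
    (bc : bool * nat) (m2 m3 : n.-bseq Sigma)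
    (coins : 'Z_(pk_N pk) * {unit 'Z_(pk_N pk)}) : option (bool * nat) :=
  let N := pk_N pk in
  let: (b, c) := bc in
  let: (a, r) := coins in
  if b || (gcdn c N != 1%N) then None
  else
    let c' : 'Z_(N ^ 2) :=
      c%:R ^+ a
      * N.+1%:R ^ (- ((a : nat)%:Z * (ToInt m2 : nat)%:Z) + (ToInt m3 : nat)%:Z)
      * (val r : nat)%:R ^+ N in
    Some (true, c' : nat).

Definition eqtest_dec (Sigma : finType) (n : nat)
    (ToInt : n.-bseq Sigma -> 'I_(#|Sigma| ^ n.+1)) (sk : paillier_sk)
    (bc : bool * nat) : option (n.-bseq Sigma) :=
  from_int ToInt (paillier_dec sk bc.2).

Definition eqtest_cond_enc (Sigma : finType) (n : nat) (C : Type)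
    (primegen : nat -> C -> nat * nat)
    (ToInt : n.-bseq Sigma -> 'I_(#|Sigma| ^ n.+1)) :
    cond_enc_alg (n.-bseq Sigma) :=
  @CondEncAlg (n.-bseq Sigma) paillier_sk paillier_pk nat (seq C)
    (fun pk => {unit 'Z_(pk_N pk)} : finType)
    (fun pk => ('Z_(pk_N pk) * {unit 'Z_(pk_N pk)})%type : finType)
    (eqtest_keygen Sigma n primegen)
    (eqtest_enc ToInt) (eqtest_condenc ToInt) (eqtest_dec ToInt).

Definition eqtest_pred (M : eqType) : rel M := fun m1 m2 => m1 == m2.

Definition eqtest_eps (R : realFieldType) (Sigma : finType) (n : nat) (lam : nat)
    (pk : paillier_pk) : R :=
  (#|Sigma| ^ n.+1)%:R / (pk_N pk)%:R.

Arguments eqtest_eps : clear implicits.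

(* Main.v *)
(* Every ciphertext (1+N)^z s^N mod N^2 decrypts to z mod N: s^(N beta) = 1 mod
   N^2 because s^beta = 1 mod N, and (1+N)^k = 1 + kN because N^2 = 0.
   A conditional ciphertext has exponent R(m1 - m2) + m3. If m1 = m2 this is m3.
   Otherwise |m1 - m2| < min(p, q) makes m1 - m2 a unit mod N, so the exponent is
   uniform mod N and meets the image of ToInt, which has at most |Sigma|^(n+1)
   elements, with probability at most |Sigma|^(n+1)/N. *)
Require Import Defs.
From HB Require Import structures.
From mathcomp Require Import all_boot all_order all_algebra.
From mathcomp Require Import cyclic.
Set Implicit Arguments.
Unset Strict Implicit.
Unset Printing Implicit Defensive.
Import Order.TTheory GRing.Theory Num.Theory.
Local Open Scope ring_scope.

(** * Powers modulo N^2 *)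

(** The binomial expansion stops at the linear term. For negative exponents, [1 - kx] inverts
    [1 + kx], since their product differs from 1 by a multiple of [x * x]. *)
Lemma exprz_1D_sqr0 (R : comUnitRingType) (x : R) (z : int) :
  x * x = 0 -> (1 + x) ^ z = 1 + x *~ z.
Proof.
move=> xx0.
have powD k : (1 + x) ^+ k = 1 + x *+ k.
  elim: k => [|k IHk]; first by rewrite expr0 mulr0n addr0.
  by rewrite exprS IHk mulrDl !mul1r mulrDr mulr1 mulrnAr xx0 mul0rn addr0
             mulrS addrA addrAC.
case: z => k; first exact: powD.
rewrite NegzE mulrNz -pmulrn -invr_expz -exprnP powD; apply: mulr1_eq.
rewrite mulrDl mul1r mulrDr mulr1 mulrN mulrnAl mulrnAr xx0 !mul0rn oppr0.
by rewrite addr0 subrK.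
Qed.

Lemma Zp_sqr_natr0 (N : nat) : (1 < N)%N -> N%:R * N%:R = 0 :> 'Z_(N ^ 2).
Proof.
by move=> N1; rewrite -natrM mulnn pchar_Zp // -(exp1n 2) ltn_exp2r.
Qed.

(** Fermat applies modulo each prime, because the lcm is a multiple of both [p.-1] and [q.-1]; the
    Chinese remainder theorem glues the two congruences. *)
Lemma expn_lcm_pred (p q s : nat) :
  prime p -> prime q -> p != q -> coprime s (p * q) ->
  (s ^ lcmn p.-1 q.-1 = 1 %[mod p * q])%N.
Proof.
move=> pp pq npq; rewrite coprimeMr => /andP[sp sq].
have fermat l b : prime l -> coprime s l -> (l.-1 %| b)%N ->
    (s ^ b == 1 %[mod l])%N.
  move=> pl sl /dvdnP[k ->]; apply/eqP.
  by rewrite mulnC expnM -modnXm -totient_prime // Euler_exp_totient // modnXm exp1n.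
apply/eqP; rewrite chinese_remainder; last first.
  by rewrite prime_coprime // dvdn_prime2.
by rewrite !fermat ?dvdn_lcml ?dvdn_lcmr.
Qed.

(** This removes the nonce in decryption. Over the naturals [s ^ b = 1 + k * N], and the [N]-th
    power of this is [1 + k * N * N], which is 1 modulo [N ^ 2]. *)
Lemma paillier_nonce_expr (p q s : nat) :
  prime p -> prime q -> p != q -> coprime s (p * q) ->
  (s%:R ^+ (p * q)) ^+ lcmn p.-1 q.-1 = 1 :> 'Z_((p * q) ^ 2).
Proof.
move=> pp pq npq cs; set N := (p * q)%N; set b := lcmn _ _.
have N1 : (1 < N)%N.
  by rewrite (leq_trans (prime_gt1 pp)) // leq_pmulr // prime_gt0.
(* Positivity makes the truncated difference [s ^ b - 1] genuine; [s = 0] is excluded because its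
   gcd with [N] is [N]. *)
have s0 : (0 < s)%N.
  by case: s cs => //; rewrite /coprime gcd0n => /eqP e; rewrite /N e in N1.
have /eqP := expn_lcm_pred pp pq npq cs; rewrite -/N -/b eqn_mod_dvd; last first.
  by rewrite expn_gt0 s0.
move=> /dvdnP[k sbE].
rewrite exprAC -natrX -(subnKC (_ : 1 <= s ^ b)%N) ?expn_gt0 ?s0 // sbE.
rewrite natrD natrM exprnP exprz_1D_sqr0.
  by rewrite -pmulrn -[_ *+ N]mulr_natr -mulrA Zp_sqr_natr0 // mulr0 addr0.
by rewrite mulrACA Zp_sqr_natr0 // mulr0.
Qed.

(** * Paillier decryption *)

Lemma paillier_L_1D (N : nat) (z : int) :
  (1 < N)%N ->
  (paillier_L N ((1 + N%:R *~ z)%R : 'Z_(N ^ 2)))%:R = z%:~R :> 'Z_N.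
Proof.
move=> N1; have N0 : (0 < N)%N by exact: ltnW.
have NN1 : (1 < N ^ 2)%N by rewrite -(exp1n 2) ltn_exp2r.
(* [paillier_L] divides the least representative, so [z] is first reduced: its multiple of [N]
   contributes [N * N = 0], and [1 + N * k] is already below [N ^ 2]. *)
pose k := `|(z %% N)%Z|%N.
have kE : (z %% N)%Z = k by rewrite gez0_abs // modz_ge0 // -lt0n.
have kN : (k < N)%N by rewrite -ltz_nat -kE ltz_pmod.
have zE : z = (z %/ N)%Z * N + k by rewrite -kE -divz_eq.
have -> : 1 + N%:R *~ z = (1 + N * k)%:R :> 'Z_(N ^ 2).
  rewrite natrD natrM mulr_natr; congr (_ + _).
  rewrite {1}zE mulrzDr mulrC mulrzA -pmulrn -[N%:R *+ N]mulr_natr.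
  by rewrite Zp_sqr_natr0 // mul0rz add0r.
have lt : (1 + N * k < N ^ 2)%N.
  rewrite -mulnn; apply: (@leq_trans (N * k.+1)); last by rewrite leq_mul2l kN orbT.
  by rewrite mulnS ltn_add2r.
rewrite val_Zp_nat // modn_small // /paillier_L add1n /= mulKn //.
by rewrite zE intrD intrM -!pmulrn pchar_Zp // mulr0 add0r.
Qed.

(** Raising to beta kills the nonce, [paillier_L] reads off [z * beta], and mu is the inverse of
    beta modulo [N]. An integer [z] and an arbitrary natural [s] coprime to [N] let the same lemma
    serve both regular and conditional ciphertexts. *)
Lemma paillier_decE (p q s : nat) (z : int) (c : 'Z_((p * q) ^ 2)) :
  prime p -> prime q -> p != q -> coprime (p * q) (p.-1 * q.-1) ->
  coprime s (p * q) ->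
  c = (p * q).+1%:R ^ z * s%:R ^+ (p * q) ->
  paillier_dec (paillier_keys p q).1 c = (z%:~R : 'Z_(p * q)).
Proof.
rewrite /paillier_dec /=; move: c; set N := (p * q)%N => c.
move=> pp pq npq cN cs cE.
have N1 : (1 < N)%N.
  by rewrite (leq_trans (prime_gt1 pp)) // leq_pmulr // prime_gt0.
have gE y : N.+1%:R ^ y = 1 + N%:R *~ y :> 'Z_(N ^ 2).
  by rewrite -exprz_1D_sqr0 ?Zp_sqr_natr0 // -natr1 addrC.
set b := lcmn _ _.
(* The lcm divides [p.-1 * q.-1], which the key generation test makes coprime to [N]. *)
have ub : (b%:R : 'Z_N) \is a GRing.unit.
  rewrite unitZpE //; apply: coprime_dvdr cN.
  by rewrite dvdn_lcm dvdn_mulr ?dvdn_mull.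
have -> : c%:R ^+ b = 1 + N%:R *~ (z * b) :> 'Z_(N ^ 2).
  by rewrite natr_Zp cE exprMn paillier_nonce_expr // mulr1 exprnP exprz_exp gE.
have -> : N.+1%:R ^+ b = 1 + N%:R *~ b :> 'Z_(N ^ 2) by rewrite exprnP gE.
rewrite -(val_Zp_nat N1); congr (nat_of_ord _).
by rewrite natrM natr_Zp !paillier_L_1D // intrM -pmulrn mulrK.
Qed.

Lemma Zp_unit_coprime (N : nat) (r : {unit 'Z_N}) :
  (1 < N)%N -> coprime (val r : nat) N.
Proof. by move=> N1; rewrite coprime_sym -unitZpE // natr_Zp; apply: valP. Qed.

Lemma from_int_ord (Sigma : finType) (n : nat)
    (ToInt : n.-bseq Sigma -> 'I_(#|Sigma| ^ n.+1)) (m : n.-bseq Sigma) :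
  injective ToInt -> from_int ToInt (ToInt m) = Some m.
Proof.
move=> inj; rewrite /from_int; case: pickP => [m' /eqP e|/(_ m)]; last by rewrite eqxx.
by congr Some; apply/inj/val_inj.
Qed.

Lemma ohead_filterP (T : Type) (a : pred T) (s : seq T) (x : T) :
  ohead (filter a s) = Some x -> a x.
Proof. by elim: s => //= y s IHs; case: ifP => // ay [<-]. Qed.

(** * The equality test for one accepted pair of primes *)

Section EqTest.

Variables (Sigma : finType) (n : nat).
Variable ToInt : n.-bseq Sigma -> 'I_(#|Sigma| ^ n.+1).
Variables (p q : nat).
Hypotheses (pp : prime p) (pq : prime q) (npq : p != q).
Hypothesis pq_accept : eqtest_accept Sigma n (p, q).

Local Notation N := (p * q)%N.
Local Notation sk := (paillier_keys p q).1.
Local Notation pk := (paillier_keys p q).2.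

Lemma eqtest_N_gt1 : (1 < N)%N.
Proof. by rewrite (leq_trans (prime_gt1 pp)) // leq_pmulr // prime_gt0. Qed.

Lemma eqtest_card_lt_min : (#|Sigma| ^ n.+1 < minn p q)%N.
Proof. by case/andP: pq_accept. Qed.

Lemma eqtest_coprime : coprime N (p.-1 * q.-1).
Proof. by case/andP: pq_accept. Qed.

Lemma eqtest_card_lt_N : (#|Sigma| ^ n.+1 < N)%N.
Proof.
apply: leq_trans eqtest_card_lt_min _; apply: leq_trans (geq_minl p q) _.
by rewrite leq_pmulr // prime_gt0.
Qed.

Lemma eqtest_ToInt_small (m : n.-bseq Sigma) :
  ((ToInt m)%:R : 'Z_N) = ToInt m :> nat.
Proof.
rewrite val_Zp_nat ?eqtest_N_gt1 // modn_small //.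
exact: ltn_trans (ltn_ord _) eqtest_card_lt_N.
Qed.

Lemma eqtest_dec_enc (m : n.-bseq Sigma) (r : {unit 'Z_(pk_N pk)}) :
  injective ToInt -> eqtest_dec ToInt sk (eqtest_enc ToInt m r) = Some m.
Proof.
move=> inj; rewrite /eqtest_dec /eqtest_enc /paillier_enc /snd.
rewrite (@paillier_decE p q (val r) (ToInt m)) ?eqtest_coprime //.
  by rewrite -pmulrn eqtest_ToInt_small from_int_ord.
by apply: Zp_unit_coprime; apply: eqtest_N_gt1.
Qed.

(** Honest ciphertexts thus pass the gcd test of CondEnc: both factors are units modulo [N ^ 2], and
    coprimality to [N ^ 2] is the same as coprimality to [N]. *)
Lemma eqtest_enc_coprime (m : nat) (r : {unit 'Z_(pk_N pk)}) :
  gcdn (paillier_enc m r) (pk_N pk) = 1%N.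
Proof.
have N1 := eqtest_N_gt1.
have NN1 : (1 < N ^ 2)%N by rewrite -(exp1n 2) ltn_exp2r.
apply/eqP; rewrite -/(coprime _ _) coprime_sym -(coprime_pexpl _ _ (isT : 0 < 2)%N).
rewrite -unitZpE // /paillier_enc natr_Zp unitrM !unitrX // unitZpE //.
  by rewrite coprime_pexpl // coprime_sym Zp_unit_coprime.
by rewrite coprime_pexpl // coprimenS.
Qed.

Lemma eqtest_dec_condenc (m1 m2 m3 : n.-bseq Sigma)
    (r2 : {unit 'Z_(pk_N pk)}) (a : 'Z_(pk_N pk)) (r3 : {unit 'Z_(pk_N pk)}) :
  obind (eqtest_dec ToInt sk)
    (eqtest_condenc ToInt (eqtest_enc ToInt m1 r2) m2 m3 (a, r3))
  = from_int ToInt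
      (a * ((ToInt m1)%:R - (ToInt m2)%:R) + (ToInt m3)%:R : 'Z_(pk_N pk))%R.
Proof.
have N1 := eqtest_N_gt1.
rewrite /eqtest_condenc /eqtest_enc eqtest_enc_coprime eqxx /orb /negb.
rewrite /obind /oapp /eqtest_dec /snd.
(* The conditional ciphertext is a Paillier ciphertext with exponent [z] and nonce
   [val r2 ^ a * val r3], taken as a natural without reduction modulo [N]. *)
pose z : int := a%:Z * (ToInt m1)%:Z + (- (a%:Z * (ToInt m2)%:Z) + (ToInt m3)%:Z).
rewrite (@paillier_decE p q (val r2 ^ a * val r3)%N z) ?eqtest_coprime //.
- congr (from_int _ (nat_of_ord _)).
  rewrite /z !intrD mulrNz !intrM -!pmulrn addrA -mulrBr.
  by rewrite (natr_Zp a).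
- by rewrite coprimeMl coprimeXl // Zp_unit_coprime.
have uN : N.+1%:R \is a @GRing.unit 'Z_(N ^ 2).
  by rewrite unitZpE ?coprime_pexpl ?coprimenS // -(exp1n 2) ltn_exp2r.
rewrite natr_Zp /paillier_enc natrM natrX !exprMn -!exprM.
rewrite /= in a r2 r3 z *.
rewrite /z (exprzDr uN (a%:Z * _)) -PoszM -exprnP [(_ * a)%N]mulnC [(N * a)%N]mulnC.
by rewrite mulrA; congr (_ * _); rewrite mulrAC.
Qed.

Lemma eqtest_condenc_ok (m1 m2 m3 : n.-bseq Sigma)
    (r2 : {unit 'Z_(pk_N pk)}) (ar : 'Z_(pk_N pk) * {unit 'Z_(pk_N pk)}) :
  exists c, eqtest_condenc ToInt (eqtest_enc ToInt m1 r2) m2 m3 ar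
            = Some (true, c).
Proof.
case: ar => a r3.
rewrite /eqtest_condenc /eqtest_enc eqtest_enc_coprime eqxx /orb /negb.
by eexists.
Qed.

Lemma eqtest_ToInt_sub_unit (m1 m2 : n.-bseq Sigma) :
  injective ToInt -> m1 != m2 ->
  ((ToInt m1)%:R - (ToInt m2)%:R : 'Z_N) \is a GRing.unit.
Proof.
move=> inj; have N1 := eqtest_N_gt1.
(* Swapping the messages only changes the sign, which preserves units; with this order the
   difference is a natural number, positive and smaller than both primes, so neither divides it. *)
wlog le21 : m1 m2 / (ToInt m2 <= ToInt m1)%N => [th|].
  case/orP: (leq_total (ToInt m2) (ToInt m1)) => le; first exact: th.
  by rewrite eq_sym => ne; rewrite -opprB unitrN; apply: th.
move=> ne; rewrite -natrB // unitZpE //.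
have d0 : (0 < ToInt m1 - ToInt m2)%N.
  rewrite subn_gt0 ltn_neqAle le21 andbT.
  by apply: contra ne => /eqP e; apply/eqP/inj/val_inj.
have := eqtest_card_lt_min; rewrite leq_min => /andP[Sp Sq].
have dlt l : (#|Sigma| ^ n.+1 < l)%N -> (ToInt m1 - ToInt m2 < l)%N.
  by apply: ltn_trans; apply: leq_ltn_trans (leq_subr _ _) (ltn_ord _).
by rewrite coprimeMl !prime_coprime // !gtnNdvd // dlt.
Qed.

(** Decryption depends on the first coin only, through an affine map whose slope is a unit. The
    nonce is free and accounts for the second factor. *)
Lemma eqtest_bad_coins (m1 m2 m3 : n.-bseq Sigma) (r2 : {unit 'Z_(pk_N pk)}) :
  injective ToInt -> m1 != m2 ->
  (#|[set ar : 'Z_(pk_N pk) * {unit 'Z_(pk_N pk)} | obind (eqtest_dec ToInt sk)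
       (eqtest_condenc ToInt (eqtest_enc ToInt m1 r2) m2 m3 ar) != None]|
   <= #|Sigma| ^ n.+1 * #|{: {unit 'Z_(pk_N pk)}}|)%N.
Proof.
move=> inj ne; set B := [set _ | _].
pose f (a : 'Z_(pk_N pk)) : 'Z_(pk_N pk) :=
  a * ((ToInt m1)%:R - (ToInt m2)%:R) + (ToInt m3)%:R.
(* All residues in the codomain of [ToInt], a superset of its image, which suffices for the
   bound. *)
pose I : {set 'Z_(pk_N pk)} := [set i%:R | i : 'I_(#|Sigma| ^ n.+1)].
have f_inj : injective f.
  by move=> a b /addIr /(mulIr (eqtest_ToInt_sub_unit inj ne)).
have sub : B \subset setX (f @^-1: I) [set: {unit 'Z_(pk_N pk)}].
  apply/subsetP => -[a r]; rewrite !inE andbT eqtest_dec_condenc -/(f a) /from_int.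
  case: pickP => // m /eqP e _; apply/imsetP; exists (ToInt m) => //.
  by rewrite e natr_Zp.
apply: leq_trans (subset_leq_card sub) _; rewrite cardsX cardsT leq_mul2r.
(* By injectivity the preimage of [I] has as many elements as its own image under [f], which lies in
   [I]. *)
apply/orP; right; rewrite -(card_imset _ f_inj).
apply: (@leq_trans #|I|); last by rewrite (leq_trans (leq_imset_card _ _)) // card_ord.
by apply/subset_leq_card/subsetP => _ /imsetP[a aI ->]; rewrite inE in aI.
Qed.

Lemma eqtest_eps_le (R : realFieldType) (lam : nat) :
  eqtest_eps R Sigma n lam pk <= 1 / (maxn p q)%:R.
Proof.
have p0 := prime_gt0 pp; have q0 := prime_gt0 pq.
rewrite /eqtest_eps /= div1r ler_pdivrMr ?ltr0n ?muln_gt0 ?p0 //.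
rewrite mulrC ler_pdivlMr ?ltr0n ?leq_max ?p0 // -natrM ler_nat.
(* Cancelling the maximum leaves the accepted bound of the alphabet power by the minimum. *)
rewrite (_ : (p * q = minn p q * maxn p q)%N) ?leq_mul2r ?(ltnW eqtest_card_lt_min) ?orbT //.
by rewrite /minn /maxn; case: ifP => //; rewrite mulnC.
Qed.

End EqTest.

(** * From counts of coins to probabilities, for all generated keys *)

(** Turns a probability bound into a count of failing coins. Nonemptiness matters: over an empty
    coin space [unif_pr] would be [0 / 0 = 0]. *)
Lemma unif_pr_ge (R : realFieldType) (T : finType) (A : {set T}) (eps : R) :
  (0 < #|T|)%N -> #|~: A|%:R <= eps * #|T|%:R -> 1 - eps <= unif_pr R A.
Proof.
move=> T0 le; rewrite /unif_pr ler_pdivlMr ?ltr0n // mulrBl mul1r.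
by rewrite lerBlDr -[leLHS](congr1 _ (cardsC A)) natrD lerD2l.
Qed.

Lemma eqtest_keygenP (Sigma : finType) (n : nat) (C : Type)
    (primegen : nat -> C -> nat * nat) (lam : nat) (tape : seq C) sk pk :
  (forall c, [/\ prime (primegen lam c).1, prime (primegen lam c).2
                & (primegen lam c).1 != (primegen lam c).2]) ->
  eqtest_keygen Sigma n primegen lam tape = Some (sk, pk) ->
  exists p q, [/\ eqtest_primes Sigma n primegen lam tape = Some (p, q),
    [/\ prime p, prime q & p != q], eqtest_accept Sigma n (p, q),
    sk = (paillier_keys p q).1 & pk = (paillier_keys p q).2].
Proof.
move=> ok; rewrite /eqtest_keygen.
case E: (eqtest_primes _ _ _ _ _) => [[p q]|] //= -[<- <-].
exists p, q; split=> //; last exact: ohead_filterP E.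
move: E; rewrite /eqtest_primes; elim: tape => //= c s IHs.
by case: ifP => _ //= [e]; have := ok c; rewrite e.
Qed.

Theorem theorem1 (R : realFieldType) (Sigma : finType) (n : nat)
  (ToInt : n.-bseq Sigma -> 'I_(#|Sigma| ^ n.+1))
  (ToInt_inj : injective ToInt)
  (C : Type) (primegen : nat -> C -> nat * nat)
  (primegen_ok : forall lam c,
     [/\ prime (primegen lam c).1, prime (primegen lam c).2
       & (primegen lam c).1 != (primegen lam c).2]) :
  let Pi := eqtest_cond_enc primegen ToInt in
  let P := @eqtest_pred (n.-bseq Sigma) in
  [/\ cond_enc_scheme Pi,
      @ce_perfectly_correct R _ Pi P,
      @ce_error_detecting R _ Pi P (eqtest_eps R Sigma n)
    & forall lam tape sk pk, ce_keygen Pi lam tape = Some (sk, pk) ->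
        exists p q : nat,
          [/\ eqtest_primes Sigma n primegen lam tape = Some (p, q),
              pk_N pk = (p * q)%N
            & eqtest_eps R Sigma n lam pk <= 1 / (maxn p q)%:R]].
Proof.
move=> Pi P; split.
- split=> //.
  + by move=> pk c m2 m3 [].
  + by move=> pk [b c] m2 m3 [a r] c' /=; case: ifP => // _ [<-].
  move=> lam tape sk pk /(eqtest_keygenP (primegen_ok lam)).
  case=> p [q [_ [pp pq npq] acc _ ->]] r2 m1 m2 m3 ar.
  exact: eqtest_condenc_ok.
- split=> lam tape sk pk /(eqtest_keygenP (primegen_ok lam));
    case=> p [q [_ [pp pq npq] acc -> ->]] r2.
    by move=> m; apply: eqtest_dec_enc.
  move=> m1 m2 m3 /eqP ->.
  have T0 : (0 < #|@ce_ccoins _ Pi (paillier_keys p q).2|)%N.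
    by apply/card_gt0P; exists (0, 1%g).
  (* With error 0 no coin may fail: for equal messages the multiplier of the random coin vanishes
     and the exponent is that of [m3]. *)
  apply: unif_pr_ge => //; rewrite mul0r (_ : ~: _ = set0) ?cards0 //.
  apply/setP => -[a r]; rewrite !inE; apply/negbTE; rewrite negbK /dec_condenc.
  apply/eqP; rewrite [LHS]eqtest_dec_condenc //.
  by rewrite subrr mulr0 add0r eqtest_ToInt_small // from_int_ord.
- move=> lam tape sk pk /(eqtest_keygenP (primegen_ok lam)).
  case=> p [q [_ [pp pq npq] acc -> ->]] r2 m1 m2 m3 ne.
  have N1 := eqtest_N_gt1 pp pq.
  have T0 : (0 < #|@ce_ccoins _ Pi (paillier_keys p q).2|)%N.
    by apply/card_gt0P; exists (0, 1%g).
  apply: unif_pr_ge => //.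
  (* The factor [p * q] of the coin count cancels the denominator of [eqtest_eps], leaving exactly
     the bound on bad coins. *)
  have -> : #|@ce_ccoins _ Pi (paillier_keys p q).2|
            = ((p * q) * #|{: {unit 'Z_(p * q)}}|)%N.
    by rewrite card_prod; congr (_ * _)%N; rewrite card_ord Zp_cast.
  rewrite [X in _ * X]natrM mulrA divfK ?pnatr_eq0 -?lt0n ?(ltnW N1) //.
  rewrite -natrM ler_nat.
  apply: leq_trans (eqtest_bad_coins pp pq npq acc m3 r2 ToInt_inj ne).
  by rewrite subset_leq_card //; apply/subsetP => ar; rewrite !inE.
- move=> lam tape sk pk /(eqtest_keygenP (primegen_ok lam)).
  case=> p [q [-> [pp pq npq] acc _ ->]]; exists p, q; split=> //.
  exact: eqtest_eps_le.
Qed.
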